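(* Let $m,n\ge1$ be integers. The number of monic $n$-smooth polynomials of degree $m$ over $\mathbb{F}_q$ is $$\sum_{l_1+2l_2+\cdots+nl_n=m}N^*\Big(m,\prod_{i=1}^nI_i^{l_i},1\Big)=q^{m}\sum_{(l_1,\dots,l_n)}\mathbf{1}\Big[\sum_{i=1}^n il_i=m\Big]\prod_{i=1}^n\binom{|I_i|+l_i-1}{l_i}q^{-il_i},$$ where the sums run over tuples of integers $l_i\ge0$, and $N^*(m,\prod_{i=1}^nI_i^{l_i},1)$ denotes the number of monic polynomials of degree $m$ over $\mathbb{F}_q$ having, for each $1\le i\le n$, exactly $l_i$ monic irreducible factors of degree $i$ counted with multiplicity.
   Context: $\mathbb{F}_q$ is a finite field with $q$ elements; $I_i$ is the set of monic irreducible polynomials of degree $i$ over $\mathbb{F}_q$. A polynomial is $n$-smooth if all its irreducible factors have degree at most $n$. $\mathbf{1}[P]$ is $1$ if $P$ is true and $0$ otherwise. *)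

(* Defs.v *)
From HB Require Import structures.
From mathcomp Require Import all_boot all_order all_algebra.
From mathcomp Require Import boolp classical_sets functions cardinality fsbigop.

Set Implicit Arguments.
Unset Strict Implicit.
Unset Printing Implicit Defensive.

Import GRing.Theory.

Local Open Scope ring_scope.

Section Smooth.
Variable F : finFieldType.

Definition monics (m : nat) : {set {poly_(m.+1) F}} :=
  [set f : {poly_(m.+1) F} |
    (polyn f \is monic) && (size (polyn f) == m.+1)].

Definition irreds (i : nat) : {set {poly_(i.+1) F}} :=
  [set g in monics i | irreducibleb g].

Definition smooth (n : nat) (f : {poly F}) : Prop :=
  forall g : {poly F}, irreducible_poly g -> g %| f -> ((size g).-1 <= n)%N.

(* For f != 0 and g nonconstant, g ^+ k %| f forces k < size f, so the bound
   on k loses nothing. *)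
Definition multiplicity (g f : {poly F}) : nat :=
  \max_(k < size f | g ^+ k %| f) k.

Definition nfactors (i : nat) (f : {poly F}) : nat :=
  (\sum_(g in irreds i) multiplicity (polyn g) f)%N.

Definition num_smooth (m n : nat) : nat :=
  #|[set f in monics m | `[< smooth n (polyn f) >]]|.

(* N^*(m, \prod_(1 <= i <= n) I_i^{l_i}, 1); the exponent l_i is l at the
   ordinal i - 1. *)
Definition Nstar (m n : nat) (l : {ffun 'I_n -> nat}) : nat :=
  #|[set f in monics m |
      [forall i : 'I_n, nfactors i.+1 (polyn f) == l i]]|.

End Smooth.

Definition weight (n : nat) (l : {ffun 'I_n -> nat}) : nat :=
  (\sum_(i < n) i.+1 * l i)%N.

(* A \sum_(l \in _) is 0 by convention when the support is infinite; this lemma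
   rules that case out for sums over the tuples of weight m, or over all tuples
   with a summand that vanishes unless the weight is m. *)
Lemma finite_weight (m n : nat) :
  finite_set [set l : {ffun 'I_n -> nat} | weight l = m]%classic.
Proof.
pose h (u : {ffun 'I_n -> 'I_m.+1}) := [ffun i => nat_of_ord (u i)].
apply: (@sub_finite_set _ _ (h @` [set: {ffun 'I_n -> 'I_m.+1}])%classic).
  move=> l /= wl; exists [ffun i => inord (l i)] => //.
  apply/ffunP => i; rewrite !ffunE inordK // ltnS -wl /weight (bigD1 i) //=.
  by rewrite mulSn -addnA leq_addr.
by apply: finite_image; exact: finite_finset.
Qed.

(* Main.v *)
(* By unique factorization, a monic f is the product of its monic irreducible
   factors of degree <= n, with multiplicities, times a monic cofactor with no
   irreducible factor of degree <= n.  Comparing degrees, f is n-smooth iff its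
   tuple of factor counts has weight deg f, which sorts the smooth polynomials by
   their tuples.  For a tuple l of weight m, the polynomials counted by N^*
   correspond to families of exponents on the sets I_i summing to l_i on I_i,
   that is, to choices of a multiset of size l_i in I_i for each i. *)
Require Import Defs.
From HB Require Import structures.
From mathcomp Require Import all_boot all_order all_algebra.
From mathcomp Require Import boolp classical_sets functions cardinality fsbigop.
From mathcomp Require finmap.

Set Implicit Arguments.
Unset Strict Implicit.
Unset Printing Implicit Defensive.

Import GRing.Theory.

Local Open Scope ring_scope.

(** * Counting multisets of a given size *)

Section WeakCompositions.
Variables (T : finType) (A : {set T}).

(* Multisets of size k in A, encoded by their multiplicities; the bound M, which
   makes the type of functions finite, is harmless as soon as k <= M. *)
Definition weak_compositions (M k : nat) : {set {ffun T -> 'I_M.+1}} :=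
  [set u : {ffun T -> 'I_M.+1} |
    [forall x, (x \notin A) ==> (u x == ord0)] &&
    ((\sum_(x in A) u x)%N == k)].

(** An enumeration of [A] turns such a function into a tuple of naturals with sum [k], and these are
    counted by stars and bars. *)
Lemma card_weak_compositions (M k : nat) :
  (k <= M)%N -> #|weak_compositions M k| = 'C(#|A| + k - 1, k).
Proof.
(* [card_ord_partitions] counts tuples of positive length, so an empty [A] is treated apart; there
   truncated subtraction gives ['C(0, 0)] for [k = 0] and ['C(k - 1, k)], hence 0, otherwise. *)
move=> kM; case cardA: #|A| => [|a].
  have A0 x : x \notin A by rewrite (cards0_eq cardA) inE.
  have wE u : (u \in weak_compositions M k) = (u == [ffun=> ord0]) && (k == 0)%N.
    rewrite inE big1 => [|x]; last by rewrite (negPf (A0 x)).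
    rewrite (eq_sym 0%N); congr andb.
    apply/forallP/eqP => [u0|-> x]; last by rewrite ffunE eqxx implybT.
    by apply/ffunP => x; rewrite ffunE; apply/eqP/(implyP (u0 x)).
  case: k {kM} wE => [|k] wE.
    by rewrite bin0 (eq_card (B := pred1 [ffun=> ord0])) ?card1// => u; rewrite wE andbT.
  rewrite add0n subn1 bin_small//=; apply: eq_card0 => u.
  by rewrite wE andbF.
have -> : (a.+1 + k - 1 = a + k)%N by rewrite addSn subn1.
have -> : 'C(a + k, k) = 'C(a + k, a) by rewrite -bin_sub ?leq_addl// addnK.
rewrite -card_ord_partitions.
pose v (i : 'I_a.+1) : T := enum_val (cast_ord (esym cardA) i).
have vA i : v i \in A by apply: enum_valP.
have v_inj : injective v by move=> i j /enum_val_inj /cast_ord_inj.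
have v_surj x : x \in A -> exists i, x = v i.
  move=> xA; exists (cast_ord cardA (enum_rank_in xA x)).
  by rewrite /v cast_ordK enum_rankK_in.
have sum_v (F : T -> nat) : (\sum_(x in A) F x = \sum_i F (v i))%N.
  rewrite big_enum_val (reindex (cast_ord (esym cardA)))//.
  by apply: onW_bij; exists (cast_ord cardA); [exact: cast_ordKV|exact: cast_ordK].
(* Each value is at most the total [k], so [inord] loses nothing on weak compositions. *)
pose phi (u : {ffun T -> 'I_M.+1}) : a.+1.-tuple 'I_k.+1 :=
  [tuple inord (u (v i)) | i < a.+1].
have phiE u i : u \in weak_compositions M k -> tnth (phi u) i = u (v i) :> nat.
  rewrite inE => /andP[_ /eqP su]; rewrite tnth_mktuple inordK// ltnS -su.
  by rewrite sum_v (bigD1 i)//= leq_addr.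
rewrite -(card_in_imset (f := phi)) => [|u w uW wW uw]; last first.
  apply/ffunP => x; apply: val_inj => /=.
  have [/v_surj[i ->]|xA] := boolP (x \in A); first by rewrite -!phiE// uw.
  move: uW wW; rewrite !inE => /andP[/forallP/(_ x) + _] /andP[/forallP/(_ x) + _].
  by rewrite xA => /eqP -> /eqP ->.
apply: eq_card => t; apply/imsetP/idP => [[u uW ->]|].
  rewrite inE big_tuple; under eq_bigr do rewrite phiE//.
  by move: uW; rewrite inE sum_v => /andP[].
rewrite inE big_tuple => /eqP st.
(* Preimage of [t] under [phi]: read the tuple along [v], with value 0 outside [A]; [k <= M] makes
   the values fit. *)
pose u : {ffun T -> 'I_M.+1} :=
  [ffun x => if [pick i | v i == x] is Some i then inord (tnth t i) else ord0].
have uv i : u (v i) = tnth t i :> nat.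
  rewrite ffunE; case: pickP => [j /eqP/v_inj ->|/(_ i)]; last by rewrite eqxx.
  by rewrite inordK// ltnS (leq_trans _ kM)// -ltnS.
have uW : u \in weak_compositions M k.
  rewrite inE sum_v; under [X in X == _]eq_bigr do rewrite uv.
  rewrite st eqxx andbT; apply/forallP => x; apply/implyP => xA; rewrite ffunE.
  by case: pickP => // i /eqP ix; rewrite -ix vA in xA.
by exists u => //; apply: eq_from_tnth => i; apply: val_inj; rewrite /= phiE// uv.
Qed.
End WeakCompositions.

(** * Multiplicities and irreducible divisors of polynomials *)

Section Multiplicity.
Variable F : finFieldType.
Implicit Types f g h : {poly F}.

(** The degree of [g ^+ k] is at least [k], so every exponent that divides lies in the range of the
    maximum; the maximum is attained, since exponent 0 always qualifies. *)
Lemma dvdp_exp_multiplicity g f k :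
  (1 < size g)%N -> f != 0 -> (g ^+ k %| f) = (k <= multiplicity g f)%N.
Proof.
move=> g1 f0; apply/idP/idP => [gkf|].
  have kf : (k < size f)%N.
    apply: leq_trans (dvdp_leq f0 gkf).
    rewrite -(prednK (n := size (g ^+ k))); last first.
      by rewrite size_poly_gt0 expf_neq0// -size_poly_gt0 ltnW.
    by rewrite ltnS size_exp leq_pmull// -subn1 subn_gt0.
  by rewrite /multiplicity (leq_bigmax_cond (Ordinal kf)).
rewrite /multiplicity.
have f_gt0 : (0 < size f)%N by rewrite size_poly_gt0.
have : (0 < #|[pred k : 'I_(size f) | (g ^+ k %| f)%R]|)%N.
  by apply/card_gt0P; exists (Ordinal f_gt0); rewrite inE expr0 dvd1p.
case/(eq_bigmax_cond (fun k : 'I_(size f) => k : nat)) => i /= gif -> ki.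
exact: dvdp_trans (dvdp_exp2l _ ki) gif.
Qed.

Lemma multiplicityP g f : (1 < size g)%N -> f != 0 ->
  exists2 h, ~~ (g %| h) & f = h * g ^+ multiplicity g f.
Proof.
move=> g1 f0.
have /dvdpP[h fE] : g ^+ multiplicity g f %| f by rewrite dvdp_exp_multiplicity.
exists h => //; apply/negP => gh.
have : g ^+ (multiplicity g f).+1 %| f by rewrite exprS {2}fE dvdp_mul.
by rewrite dvdp_exp_multiplicity// ltnn.
Qed.

Lemma multiplicity_uniq g h k : (1 < size g)%N -> ~~ (g %| h) ->
  multiplicity g (h * g ^+ k) = k.
Proof.
move=> g1 gh.
have h0 : h != 0 by apply: contraNneq gh => ->; rewrite dvdp0.
have g0 : g != 0 by rewrite -size_poly_gt0 ltnW.
have f0 : h * g ^+ k != 0 by rewrite mulf_neq0// expf_neq0.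
apply/eqP; rewrite eqn_leq -dvdp_exp_multiplicity// dvdp_mulIr andbT leqNgt.
by rewrite -dvdp_exp_multiplicity// exprS dvdp_mul2r// expf_neq0.
Qed.

Lemma multiplicity_eq0 g f : (1 < size g)%N -> ~~ (g %| f) ->
  multiplicity g f = 0%N.
Proof. by move=> g1 gf; rewrite -{1}(mulr1 f) -(expr0 g) multiplicity_uniq. Qed.

(** Euclid's lemma: the gcd of [g] and [f] is either constant, and Gauss applies, or associate to
    [g], and then [g] divides [f]. *)
Lemma irreducible_dvdp_mul g f h : irreducible_poly g ->
  (g %| f * h) = (g %| f) || (g %| h).
Proof.
move=> irg; apply/idP/orP => [gfh|[]]; [|exact: dvdp_mulr|exact: dvdp_mull].
have [gf|ngf] := boolP (g %| f); [by left|right].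
rewrite -(Gauss_dvdpr _ (_ : coprimep g f))// coprimep_def.
have [//|s1] := boolP (size (gcdp g f) == 1%N).
have := irg.2 _ s1 (dvdp_gcdl g f) => /eqp_dvdl e.
by rewrite -e dvdp_gcdr in ngf.
Qed.

(** Once the full powers of [g] are split off, neither cofactor is divisible by [g], hence by
    Euclid's lemma neither is their product. *)
Lemma multiplicityM g f h : irreducible_poly g -> f != 0 -> h != 0 ->
  multiplicity g (f * h) = (multiplicity g f + multiplicity g h)%N.
Proof.
move=> irg f0 h0; have g1 := irg.1.
have [f' gf' fE] := multiplicityP g1 f0; have [h' gh' hE] := multiplicityP g1 h0.
rewrite {1}fE {1}hE mulrACA -exprD multiplicity_uniq//.
by rewrite irreducible_dvdp_mul// negb_or gf'.
Qed.

Lemma multiplicity1 g : (1 < size g)%N -> multiplicity g 1 = 0%N.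
Proof.
move=> g1; apply: multiplicity_eq0 => //.
by rewrite dvdp1 neq_ltn g1 orbT.
Qed.

Lemma multiplicityX g f k : irreducible_poly g -> f != 0 ->
  multiplicity g (f ^+ k) = (k * multiplicity g f)%N.
Proof.
move=> irg f0; elim: k => [|k IH]; first by rewrite expr0 mul0n multiplicity1// irg.1.
by rewrite exprS multiplicityM ?expf_neq0// IH mulSn.
Qed.

Lemma multiplicity_prod (I : finType) (P : pred I) (G : I -> {poly F}) g :
    irreducible_poly g -> (forall i, P i -> G i != 0) ->
  multiplicity g (\prod_(i | P i) G i) = (\sum_(i | P i) multiplicity g (G i))%N.
Proof.
move=> irg G0.
(* Nonvanishing is carried through the induction because [multiplicityM] asks for two nonzero
   factors. *)
suff [] : \prod_(i | P i) G i != 0 /\ multiplicity g (\prod_(i | P i) G i) =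
  (\sum_(i | P i) multiplicity g (G i))%N by [].
elim/big_rec2: _ => [|i k f Pi [f0 <-]].
  by rewrite oner_neq0 multiplicity1// irg.1.
by rewrite mulf_neq0 ?multiplicityM ?G0.
Qed.

Lemma multiplicity_irreducible g h :
    irreducible_poly g -> irreducible_poly h -> g \is monic -> h \is monic ->
  multiplicity g h = (g == h).
Proof.
move=> irg irh mg mh; have g1 := irg.1.
have [<-|gh] := eqVneq g h.
  rewrite -{2}(mul1r g) -{2}(expr1 g) multiplicity_uniq//.
  by rewrite dvdp1 neq_ltn g1 orbT.
rewrite multiplicity_eq0//; apply: contra gh => gdvdh.
by rewrite -eqp_monic// irh.2// neq_ltn g1 orbT.
Qed.

Lemma degree_prod (I : finType) (P : pred I) (G : I -> {poly F}) :
    (forall i, P i -> G i != 0) ->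
  (size (\prod_(i | P i) G i)).-1 = (\sum_(i | P i) (size (G i)).-1)%N.
Proof.
move=> G0.
suff [] : \prod_(i | P i) G i != 0 /\ (size (\prod_(i | P i) G i)).-1 =
  (\sum_(i | P i) (size (G i)).-1)%N by [].
elim/big_rec2: _ => [|i k f Pi [f0 <-]]; first by rewrite oner_neq0 size_poly1.
rewrite mulf_neq0 ?size_mul ?G0//; split=> //.
by rewrite polySpred ?G0// [in LHS](polySpred f0) addSn addnS.
Qed.

Lemma monic_size_le1 f : f \is monic -> (size f <= 1)%N -> f = 1.
Proof. by move=> + /size1_polyC fE; rewrite fE monicE lead_coefC => /eqP ->. Qed.

Lemma monic_irreducible_associate f : irreducible_poly f ->
  exists g, [/\ g \is monic, irreducible_poly g & g %= f].
Proof.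
move=> irf; have c0 : (lead_coef f)^-1 != 0.
  by rewrite invr_eq0 lead_coef_eq0 irredp_neq0.
have cf := eqp_scale f c0.
exists ((lead_coef f)^-1 *: f); split=> //.
  by rewrite monicE lead_coefZ mulVf// lead_coef_eq0 irredp_neq0.
split=> [|q q1]; first by rewrite size_scale// irf.1.
by rewrite dvdpZr// => /(irf.2 _ q1) qf; rewrite (eqp_trans qf)// eqp_sym.
Qed.

Lemma irreducible_divisor f : (1 < size f)%N ->
  exists2 g, irreducible_poly g & g %| f.
Proof.
have [k] := ubnP (size f); elim: k f => // k IH f; rewrite ltnS => fk f1.
have [/irreducibleP irf|] := boolP (irreducibleb f); first by exists f.
(* The boolean test ranges over [q] of size at most [(size f).-1], so its failure yields a
   nonconstant divisor to which the induction applies. *)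
rewrite /irreducibleb f1 /= negb_forall => /existsP[q].
rewrite negb_imply -ltnNge -Pdiv.Idomain.dvdpE => /andP[qf q1].
have [|g irg gq] := IH q _ q1.
  by apply: leq_ltn_trans (size_npoly q) (leq_trans _ fk); rewrite ltn_predL ltnW.
by exists g => //; apply: dvdp_trans gq qf.
Qed.

Lemma in_irreds i (g : {poly_(i.+1) F}) : (g \in irreds F i) =
  [&& polyn g \is monic, size (polyn g) == i.+1 & irreducibleb (polyn g)].
Proof. by rewrite !inE andbA. Qed.

Lemma irredsP i (g : {poly_(i.+1) F}) : g \in irreds F i ->
  [/\ polyn g \is monic, size (polyn g) = i.+1, polyn g != 0 & irreducible_poly (polyn g)].
Proof.
rewrite in_irreds => /and3P[mg /eqP sg /irreducibleP irg]; split=> //.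
exact: monic_neq0.
Qed.
End Multiplicity.

(** * Factorization into irreducibles of degree at most [n] *)

Section Factorization.
Variables (F : finFieldType) (n : nat).
Implicit Types f g h : {poly F}.

(** The ordinal [i] stands for degree [i.+1], hence for polynomials of size [i.+2]. *)
Definition irreducible_product (e : forall i : 'I_n, {poly_(i.+2) F} -> nat) :=
  \prod_(i < n) \prod_(g in irreds F i.+1) polyn g ^+ e i g.

Definition multiplicities f (i : 'I_n) (g : {poly_(i.+2) F}) : nat :=
  multiplicity (polyn g) f.

Definition factor_counts (f : {poly F}) : {ffun 'I_n -> nat} :=
  [ffun i : 'I_n => nfactors i.+1 f].

Lemma irreducible_product_monic e : irreducible_product e \is monic.
Proof.
apply: monic_prod => i _; apply: monic_prod => g /irredsP[mg _ _ _].
exact: monic_exp.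
Qed.

(** Uniqueness half of unique factorization: distinct monic irreducibles do not divide each other,
    so only the factor [h] itself contributes. *)
Lemma multiplicity_irreducible_product e (j : 'I_n) (h : {poly_(j.+2) F}) :
  h \in irreds F j.+1 -> multiplicity (polyn h) (irreducible_product e) = e j h.
Proof.
move=> hirr; have [mh sh _ irh] := irredsP hirr.
have nz i (g : {poly_(i.+2) F}) : g \in irreds F i.+1 -> forall k, polyn g ^+ k != 0.
  by move=> /irredsP[_ _ g0 _] k; rewrite expf_neq0.
have inner (i : 'I_n) : multiplicity (polyn h) (\prod_(g in irreds F i.+1) polyn g ^+ e i g) =
  (\sum_(g in irreds F i.+1) e i g * (polyn h == polyn g))%N.
  rewrite multiplicity_prod// => [|g gi]; last exact: nz.
  apply: eq_bigr => g gi; have [mg _ g0 irg] := irredsP gi.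
  by rewrite multiplicityX// multiplicity_irreducible.
rewrite multiplicity_prod// => [|i _]; last first.
  by rewrite prodf_seq_neq0; apply/allP => g _; apply/implyP => gi; exact: nz.
under eq_bigr do rewrite inner.
rewrite (bigD1 j)//= (bigD1 h)//= eqxx muln1 !big1 ?addn0// => [i ij|g /andP[_ gh]].
  rewrite big1// => g /irredsP[_ sg _ _].
  have [hg|] := eqVneq (polyn h) (polyn g); last by rewrite muln0.
  by case/eqP: ij; apply: val_inj; move: sg; rewrite -hg sh => -[].
by rewrite eq_sym val_eqE (negPf gh) muln0.
Qed.

Lemma degree_irreducible_product e :
  (size (irreducible_product e)).-1 =
  (\sum_(i < n) i.+1 * \sum_(g in irreds F i.+1) e i g)%N.
Proof.
rewrite degree_prod => [|i _]; last first.
  by apply/monic_neq0/monic_prod => g /irredsP[mg _ _ _]; exact: monic_exp.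
apply: eq_bigr => i _; rewrite degree_prod => [|g /irredsP[_ _ g0 _]]; last first.
  by rewrite expf_neq0.
rewrite big_distrr; apply: eq_bigr => g /irredsP[_ sg _ _].
by rewrite size_exp sg.
Qed.

(** Existence half, by induction on the size: while some monic irreducible of degree at most [n]
    divides [f], one copy of it is divided out. *)
Lemma multiplicity_factorization f : f \is monic ->
  exists2 h, f = h * irreducible_product (multiplicities f) &
    h \is monic /\
    forall g, irreducible_poly g -> ((size g).-1 <= n)%N -> ~~ (g %| h).
Proof.
have [k] := ubnP (size f); elim: k f => // k IH f; rewrite ltnS => fk mf.
have [[j [g gj gf]]|nodiv] := EM (exists j : 'I_n, exists2 g : {poly_(j.+2) F},
    g \in irreds F j.+1 & polyn g %| f); last first.
  exists f; last first.
    split=> // g irg gn; apply/negP => gf; apply: nodiv.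
    (* An arbitrary irreducible [g] is replaced by its monic associate [g']; its degree is
       [(size g').-1], so its index below [n] is [(size g').-2]. *)
    have [g' [mg' irg' gg']] := monic_irreducible_associate irg.
    have sg := eqp_size gg'; have s1 := irg'.1.
    have jn : ((size g').-2 < n)%N.
      by apply: leq_trans gn; rewrite -sg; case: (size g') s1 => [|[]].
    have sg' : size g' = (size g').-2.+2 by case: (size g') s1 => [|[]].
    exists (Ordinal jn), (npolyp _ g'); last by rewrite npolypK -?sg'// (eqp_dvdl _ gg').
    by rewrite in_irreds npolypK -?sg'// mg' eqxx; apply/irreducibleP.
  rewrite /irreducible_product big1 ?mulr1// => i _; rewrite big1// => g gi.
  have [_ _ _ irg] := irredsP gi.
  rewrite /multiplicities multiplicity_eq0 ?expr0//; first exact: irg.1.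
  by apply/negP => gf; apply: nodiv; exists i, g.
have [mg sg g0 irg] := irredsP gj; have /dvdpP[f' fE] := gf.
have mf' : f' \is monic by rewrite fE monicMr in mf.
have f'0 := monic_neq0 mf'.
have [|h f'E [mh hP]] := IH f' _ mf'.
  by apply: leq_trans fk; rewrite fE size_mul// sg !addnS /= ltnS leq_addr.
exists h => //; rewrite {1}fE {1}f'E -mulrA; congr (_ * _).
rewrite /irreducible_product /multiplicities (bigD1 j)//= [in RHS](bigD1 j)//=.
rewrite (bigD1 g)//= [in RHS](bigD1 g)//=.
(* Passing from [f'] to [f] raises only the exponent of [g], by one. *)
have bump i (h' : {poly_(i.+2) F}) : h' \in irreds F i.+1 ->
    multiplicity (polyn h') f = (multiplicity (polyn h') f' + (polyn h' == polyn g))%N.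
  move=> hi'; have [mh' _ _ irh'] := irredsP hi'.
  by rewrite fE multiplicityM// (multiplicity_irreducible irh' irg).
rewrite [in RHS]bump// eqxx addn1 exprS mulrC -!mulrA; congr (_ * (_ * (_ * _))).
  apply: eq_bigr => h' /andP[h'j h'g]; rewrite [in RHS]bump//.
  by rewrite val_eqE (negPf h'g) addn0.
apply: eq_bigr => i ij; apply: eq_bigr => h' h'i; rewrite [in RHS]bump//.
case: eqVneq => [e|_]; last by rewrite addn0.
have [_ sh' _ _] := irredsP h'i.
by case/eqP: ij; apply: val_inj; move: sh'; rewrite e sg => -[].
Qed.

Lemma degree_factor_counts f :
  (size (irreducible_product (multiplicities f))).-1 =
  weight (factor_counts f).
Proof.
rewrite degree_irreducible_product /weight; apply: eq_bigr => i _.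
by rewrite ffunE.
Qed.

(** The weight is the degree of the product of small factors, so the cofactor is monic of degree 0,
    that is 1. *)
Lemma factor_counts_weight f : f \is monic -> weight (factor_counts f) = (size f).-1 ->
  f = irreducible_product (multiplicities f).
Proof.
move=> mf wf; have [h fE [mh _]] := multiplicity_factorization mf.
set p := irreducible_product _ in fE *.
have p0 : p != 0 by apply/monic_neq0/irreducible_product_monic.
have : size h == 1%N.
  have h0 := monic_neq0 mh.
  move: wf; rewrite -degree_factor_counts -/p {1}fE size_mul//.
  rewrite (polySpred p0) (polySpred h0) addnS addSn /= => /eqP.
  by rewrite -[X in X == _]add0n eqn_add2r eq_sym => /eqP ->.
by move=> /eqP h1; rewrite fE (monic_size_le1 mh) ?h1// mul1r.
Qed.

(** If [f] is smooth, a nonconstant cofactor would have an irreducible divisor of degree at most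
    [n], which it excludes. Conversely, equal degrees leave only small factors. *)
Lemma smooth_weight f : f \is monic ->
  smooth n f <-> weight (factor_counts f) = (size f).-1.
Proof.
move=> mf; split=> [sf|wf].
  have [h fE [mh hP]] := multiplicity_factorization mf.
  have [h1|h1] := ltnP 1 (size h).
    have [g irg gh] := irreducible_divisor h1.
    have gf : g %| f by rewrite fE dvdp_mulr.
    by have := hP g irg (sf g irg gf); rewrite gh.
  by rewrite -degree_factor_counts {2}fE (monic_size_le1 mh h1) mul1r.
move=> g irg; rewrite (factor_counts_weight mf wf).
(* By Euclid's lemma [K] is stable under products, so it need only be checked on 1 and on each
   irreducible factor. *)
pose K (p : {poly F}) := g %| p -> ((size g).-1 <= n)%N.
have K1 : K 1 by rewrite /K dvdp1 => /eqP g1; have := irg.1; rewrite g1.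
have KM p q : K p -> K q -> K (p * q).
  by move=> Kp Kq; rewrite /K irreducible_dvdp_mul// => /orP[/Kp|/Kq].
apply: (big_ind K) => // i _; apply: (big_ind K) => // h hi.
elim: (multiplicities _ _) => [//|k IH]; rewrite exprS; apply: KM => // gh.
have [_ sh _ irh] := irredsP hi.
have /irh.2/(_ gh)/eqp_size -> : size g != 1%N by rewrite neq_ltn irg.1 orbT.
by rewrite sh; exact: ltn_ord.
Qed.

(** * Counting polynomials through families of exponents *)

Lemma monicsP m (f : {poly_(m.+1) F}) : f \in monics F m ->
  polyn f \is monic /\ (size (polyn f)).-1 = m.
Proof. by rewrite inE => /andP[mf /eqP ->]. Qed.

(** Bounding exponents by [m] gives a finite type and excludes nothing for tuples of weight [m],
    whose entries are at most [m]. *)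
Definition exponent_fun m (i : 'I_n) : finType := {ffun {poly_(i.+2) F} -> 'I_m.+1}.

Definition exponents m (l : {ffun 'I_n -> nat}) :
    {set {dffun forall i : 'I_n, exponent_fun m i}} :=
  [set e : {dffun forall i : 'I_n, exponent_fun m i} |
    [forall i, e i \in weak_compositions (irreds F i.+1) m (l i)]].

Lemma leq_weight (l : {ffun 'I_n -> nat}) i : (l i <= weight l)%N.
Proof. by rewrite /weight (bigD1 i)//= mulSn -addnA leq_addr. Qed.

Lemma card_exponents m l : weight l = m ->
  #|exponents m l| = (\prod_(i < n) 'C(#|irreds F i.+1| + l i - 1, l i))%N.
Proof.
move=> wl; pose W (i : 'I_n) := mem (weak_compositions (irreds F i.+1) m (l i)).
pose fW : simpl_pred {dffun forall i : 'I_n, exponent_fun m i} :=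
  family (fun i => W i : pred (exponent_fun m i)).
have -> : #|exponents m l| = #|fW|.
  by apply: eq_card => e; rewrite inE.
(* The choices for different degrees are independent, so the cardinals multiply. *)
rewrite (card_family (fun i => W i : pred (exponent_fun m i))) foldrE big_map big_enum.
apply: eq_bigr => i _; have lm : (l i <= m)%N by rewrite -wl leq_weight.
by rewrite -(card_weak_compositions _ lm).
Qed.

Definition exponent_at m (e : {dffun forall i : 'I_n, exponent_fun m i}) (i : 'I_n)
  (g : {poly_(i.+2) F}) : nat := e i g.

Definition exponents_poly m (e : {dffun forall i : 'I_n, exponent_fun m i}) :
    {poly_(m.+1) F} :=
  npolyp m.+1 (irreducible_product (exponent_at e)).

Lemma exponents_polyE m l e : weight l = m -> e \in exponents m l ->
  polyn (exponents_poly e) = irreducible_product (exponent_at e) /\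
  (size (irreducible_product (exponent_at e)) = m.+1).
Proof.
move=> wl eE; suff s : size (irreducible_product (exponent_at e)) = m.+1.
  by rewrite npolypK ?s.
rewrite polySpred; last by apply/monic_neq0/irreducible_product_monic.
congr _.+1; rewrite degree_irreducible_product -[RHS]wl; apply: eq_bigr => i _.
by move: eE; rewrite inE => /forallP/(_ i); rewrite inE => /andP[_ /eqP ->].
Qed.

(** [exponents_poly] maps [exponents m l] bijectively onto the polynomials counted: multiplicities
    recover the exponents, and every such polynomial is the product of its small factors. *)
Lemma NstarE m l : weight l = m ->
  Nstar F m l = (\prod_(i < n) 'C(#|irreds F i.+1| + l i - 1, l i))%N.
Proof.
move=> wl; rewrite -(card_exponents wl).
rewrite -(card_in_imset (f := @exponents_poly m)); last first.
  move=> d e dE eE de; apply/ffunP => i; apply/ffunP => g; apply: val_inj => /=.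
  have [dP _] := exponents_polyE wl dE; have [eP _] := exponents_polyE wl eE.
  have [gi|gi] := boolP (g \in irreds F i.+1).
    rewrite -/(exponent_at d g) -/(exponent_at e g).
    rewrite -(multiplicity_irreducible_product _ gi).
    rewrite -(multiplicity_irreducible_product (exponent_at e) gi).
    by rewrite -dP -eP de.
  (* Away from the irreducibles both families vanish by the definition of [weak_compositions]. *)
  move: dE eE; rewrite !inE => /forallP/(_ i) + /forallP/(_ i).
  rewrite !inE => /andP[/forallP/(_ g) + _] /andP[/forallP/(_ g) + _].
  by rewrite gi => /eqP -> /eqP ->.
apply: eq_card => f; rewrite inE; apply/andP/imsetP => [[fm /forallP fl]|[e eE ->]].
  have [mf sf] := monicsP fm.
  have cl : factor_counts f = l by apply/ffunP => i; rewrite ffunE; apply/eqP.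
  have wf : weight (factor_counts f) = (size (polyn f)).-1 by rewrite cl wl sf.
  (* The preimage of [f] is its family of multiplicities; each is at most [l i], hence at most [m],
     so [inord] is exact. *)
  pose e : {dffun forall i : 'I_n, exponent_fun m i} := [ffun i : 'I_n =>
    [ffun g : {poly_(i.+2) F} => if g \in irreds F i.+1
      then inord (multiplicity (polyn g) f) else ord0] : exponent_fun m i].
  have eiE (i : 'I_n) (g : {poly_(i.+2) F}) : g \in irreds F i.+1 ->
      e i g = multiplicity (polyn g) f :> nat.
    have lm : (l i <= m)%N by rewrite -wl leq_weight.
    move=> gi; rewrite !ffunE gi inordK// ltnS; apply: leq_trans lm.
    by rewrite -(eqP (fl i)) /nfactors (bigD1 g)//= leq_addr.
  have eP : irreducible_product (exponent_at e) = f.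
    rewrite [RHS](factor_counts_weight mf wf); apply: eq_bigr => i _.
    by apply: eq_bigr => g gi; rewrite /exponent_at eiE.
  exists e; last by apply: val_inj; rewrite /exponents_poly eP /= npolypK.
  rewrite inE; apply/forallP => i; rewrite inE; apply/andP; split.
    by apply/forallP => g; apply/implyP => /negPf gi; rewrite !ffunE gi.
  rewrite -(eqP (fl i)); apply/eqP/eq_bigr => g gi; exact: eiE.
have [eP es] := exponents_polyE wl eE; rewrite eP; split.
  by rewrite inE eP es eqxx irreducible_product_monic.
apply/forallP => i; rewrite /nfactors.
under eq_bigr => g gi do rewrite multiplicity_irreducible_product//.
by move: eE; rewrite inE => /forallP/(_ i); rewrite inE => /andP[].
Qed.

(** Exchanging the sums, each monic [f] is counted once if [factor_counts f] is in [s] and never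
    otherwise; by [smooth_weight] this membership is smoothness. *)
Lemma num_smooth_sum m (s : seq {ffun 'I_n -> nat}) : uniq s ->
    (forall l, (l \in s) = (weight l == m)) ->
  num_smooth F m n = (\sum_(l <- s) Nstar F m l)%N.
Proof.
move=> us sP; rewrite /num_smooth -sum1_card.
have NE l : Nstar F m l = (\sum_(f in monics F m) (l == factor_counts f))%N.
  rewrite /Nstar -sum1_card big_mkcond [RHS]big_mkcond; apply: eq_bigr => f _.
  rewrite inE; case: (f \in _) => //=.
  suff -> : [forall i : 'I_n, nfactors i.+1 f == l i] = (l == factor_counts f).
    by case: eqP.
  apply/forallP/eqP => [fl|-> i]; last by rewrite ffunE.
  by apply/ffunP => i; rewrite ffunE; apply/esym/eqP.
under [RHS]eq_bigr do rewrite NE.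
rewrite exchange_big /= [LHS]big_mkcond [RHS]big_mkcond; apply: eq_bigr => f _.
rewrite inE; have [fm|//] := boolP (f \in _).
have [mf sf] := monicsP fm.
have -> : (\sum_(l <- s) (l == factor_counts f) = (factor_counts f \in s))%N.
  rewrite -count_uniq_mem// -sum1_count [RHS]big_mkcond.
  by apply: eq_bigr => l _ /=; case: eqP.
rewrite sP /=; have -> : `[< smooth n f >] = (weight (factor_counts f) == m).
  by have [] := smooth_weight mf; rewrite sf => sw ws; apply/asboolP/eqP.
by case: eqP.
Qed.
End Factorization.

(** * Assembling the two identities over the rationals *)

Theorem corollary14 (F : finFieldType) (m n : nat)
    (hm : (1 <= m)%N) (hn : (1 <= n)%N) :
  ((num_smooth F m n)%:R : rat) =
    \sum_(l \in [set l : {ffun 'I_n -> nat} | weight l = m]%classic)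
      ((Nstar F m l)%:R : rat)
  /\
  \sum_(l \in [set l : {ffun 'I_n -> nat} | weight l = m]%classic)
      ((Nstar F m l)%:R : rat) =
    (#|F|%:R : rat) ^+ m *
      \sum_(l \in [set: {ffun 'I_n -> nat}]%classic)
        (((weight l == m)%:R : rat) *
         \prod_(i < n) (('C((#|irreds F i.+1| + l i - 1)%N, l i)%:R : rat) *
                        (#|F|%:R : rat) ^- (i.+1 * l i))).
Proof.
have finW := finite_weight m n; split.
  rewrite fsbig_finite// -natr_sum; congr _%:R.
  apply: num_smooth_sum; first exact: finmap.fset_uniq.
  by move=> l; rewrite in_fset_set//; apply/idP/eqP; rewrite inE.
rewrite mulr_fsumr.
(* The indicator kills the tuples of other weights, which reduces the sum to those of weight [m]. *)
rewrite -[RHS](fsbig_widen [set l : {ffun 'I_n -> nat} | weight l = m]%classic); last 2 first.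
- by [].
- by move=> l /= [_ /eqP/negPf ->]; rewrite mul0r mulr0.
apply: eq_fsbigr => l; rewrite inE => wl; rewrite wl eqxx mul1r NstarE// big_split /=.
have q0 : (#|F|%:R : rat) != 0.
  by rewrite Num.Theory.pnatr_eq0 -lt0n; apply/card_gt0P; exists 0.
(* The inverse powers of [#|F|] combine to exponent [weight l], which is [m], and cancel the
   prefactor. *)
rewrite natr_prod prodfV prodrXr -/(weight l) wl mulrCA mulfV ?mulr1//.
by rewrite expf_neq0.
Qed.
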